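(* Let $M$ be a positive integer and $\nu=1/M$. There exist a calibrated forecasting procedure with one-dimensional signals (see context) and positive constants $c,c'$ such that, for the randomized trading strategy based on it, the following holds for every price sequence $S_0,S_1,S_2,\dots\in[0,1]$ with $S_1=S_0$, all $0<\epsilon<1$, all $0<\gamma<1$ and all $n$: with (internal) probability at least $1-e^{-c'\sqrt n}$, if $$\sum_{i=1}^n I(\tilde p_i>\tilde S_{i-1}+\epsilon)\ \ge\ \frac{c\,n^{3/4+\nu}}{\gamma\epsilon},$$ then $k_n\ge(1-\gamma)\epsilon$.
   Context: Trading game. $S_0,S_1,S_2,\dots$ are stock prices rescaled so that $0\le S_i\le1$, with $S_1=S_0$; $\Delta S_i=S_i-S_{i-1}$. At step $i$ the forecaster uses the signal $x_i=S_{i-1}$ and announces a randomized forecast $\tilde p_i\in[0,1]$ of $S_i$; the past price is also randomized, giving $\tilde S_{i-1}=\tilde x_i$. Forecasting with signals in $[0,1]$. A forecasting algorithm is a deterministic rule which at each step $n$ computes a forecast $p_n\in[0,1]$ from the past outcomes $S_1,\dots,S_{n-1}$ and the signals $x_1,\dots,x_n\in[0,1]$. A method of randomization is a rule which, for each step $n$, assigns to every $y\in[0,1]$ a probability distribution on $[0,1]$ with mean $y$; $\tilde p_n$ and $\tilde x_n$ are drawn from the distributions assigned at step $n$ to $p_n$ and $x_n$, independently of each other and across steps. ''Internal probability'' is the probability $Pr$ with respect to this randomization. A calibrated forecasting procedure is a forecasting algorithm together with a method of randomization such that for all sequences $S_1,S_2,\dots\in[0,1]$ and $x_1,x_2,\dots\in[0,1]$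 and every $\mathcal S\subseteq[0,1]^2$ with characteristic function $\chi$, one has $\lim_{n\to\infty}\frac1n\sum_{i=1}^n\chi(\tilde p_i,\tilde x_i)(S_i-\tilde p_i)=0$ with $Pr$-probability $1$, and $E(\tilde p_n-p_n)^2\to0$, $E(\tilde x_n-x_n)^2\to0$ as $n\to\infty$. Trading strategy (playing for a rise) with entry threshold $\epsilon$: at step $i$ buy one share at price $S_{i-1}$ if $\tilde p_i>\tilde S_{i-1}+\epsilon$ and sell it at price $S_i$; otherwise pass the step. $I(\tilde p_i>\tilde S_{i-1}+\epsilon)$ equals $1$ if $\tilde p_i>\tilde S_{i-1}+\epsilon$ and $0$ otherwise. The total gain is $\mathcal K_n=\sum_{i=1}^n I(\tilde p_i>\tilde S_{i-1}+\epsilon)\,\Delta S_i$, and the average income per gamble is $$k_n=\frac{\mathcal K_n}{\sum_{i=1}^n I(\tilde p_i>\tilde S_{i-1}+\epsilon)}.$$ *)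

(* Defs.v *)
From HB Require Import structures.
From mathcomp Require Import all_boot all_order all_algebra.
From mathcomp Require Import all_classical all_reals all_analysis.

Set Implicit Arguments.
Unset Strict Implicit.
Unset Printing Implicit Defensive.

Import Order.TTheory GRing.Theory Num.Theory.
Import numFieldNormedType.Exports.

Local Open Scope classical_set_scope.
Local Open Scope ring_scope.

(* Time steps are numbered from 1: in a sequence indexed by nat, the entry of
   index 0 is unused, except for the price S 0. *)

Section Procedure.
Context {R : realType}.

(* The arguments are [:: S_1; ...; S_(n-1)] and [:: x_1; ...; x_n]; the step n
   is the length of the second one. *)
Record forecasting_algorithm := ForecastingAlgorithm {
  forecast_rule :> seq R -> seq R -> R ;
  forecast_rule_itv : forall s x : seq R, size x = (size s).+1 ->
    (forall u, u \in s -> 0 <= u <= 1) -> (forall u, u \in x -> 0 <= u <= 1) ->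
    0 <= forecast_rule s x <= 1 }.

Definition forecast (A : forecasting_algorithm) (S x : nat -> R) (n : nat) : R :=
  A [seq S i | i <- iota 1 n.-1] [seq x i | i <- iota 1 n].

Record randomization_method := RandomizationMethod {
  random_law :> nat -> R -> probability R R ;
  random_law_itv : forall n (y : R), 0 <= y <= 1 ->
    random_law n y `[0, 1]%classic = 1%E ;
  random_law_mean : forall n (y : R), 0 <= y <= 1 ->
    ('E_(random_law n y)[fun u => u] = y%:E)%E }.

End Procedure.
Arguments forecasting_algorithm R : clear implicits.
Arguments randomization_method R : clear implicits.

Section Randomization.
Context {R : realType} {d : measure_display} {T : measurableType d}.
Variable P : probability T R.

Definition mutually_independent (I : eqType) (X : I -> {RV P >-> R}) : Prop :=
  forall (J : seq I) (B : I -> set R), uniq J -> (forall i, measurable (B i)) ->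
    P (\bigcap_(i in [set` J]) X i @^-1` B i) =
    (\prod_(i <- J) P (X i @^-1` B i))%E.

(* Equality of laws is asked on Borel sets only, because the value of a measure
   on a nonmeasurable set is arbitrary. *)
Definition has_law (X : {RV P >-> R}) (mu : probability R R) : Prop :=
  forall B : set R, measurable B -> distribution P X B = mu B.

(* pt and xt are the randomized forecasts and the randomized signals. *)
Definition randomized_run (A : forecasting_algorithm R)
    (D : randomization_method R) (S x : nat -> R)
    (pt xt : nat -> {RV P >-> R}) : Prop :=
  [/\ forall n, (0 < n)%N -> has_law (pt n) (D n (forecast A S x n)),
      forall n, (0 < n)%N -> has_law (xt n) (D n (x n)) &
      mutually_independent (fun j : nat + nat =>
        match j with inl i => pt i.+1 | inr i => xt i.+1 end)].

End Randomization.

(* The joint law of a randomized run is determined by A, D, S and x, so the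
   internal probability is rendered by quantifying over all its realizations.
   The set E is arbitrary and the event below need not be measurable: {ae P, _}
   says that its complement is contained in a null set. *)
Definition calibrated {R : realType} (A : forecasting_algorithm R)
    (D : randomization_method R) : Prop :=
  forall S x : nat -> R,
    (forall i, (0 < i)%N -> 0 <= S i <= 1) ->
    (forall i, (0 < i)%N -> 0 <= x i <= 1) ->
  forall (d : measure_display) (T : measurableType d) (P : probability T R)
    (pt xt : nat -> {RV P >-> R}), randomized_run A D S x pt xt ->
  [/\ forall E : set (R * R), E `<=` `[0, 1]%classic `*` `[0, 1]%classic ->
        {ae P, forall w : T,
          (fun n : nat => n%:R^-1 *
             \sum_(1 <= i < n.+1) \1_E (pt i w, xt i w) * (S i - pt i w))
          @ \oo --> (0 : R)},
      (fun n => 'E_P[fun w => ((pt n w - forecast A S x n) ^+ 2)%R]%E)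
        @ \oo --> 0%E &
      (fun n => 'E_P[fun w => ((xt n w - x n) ^+ 2)%R]%E)
        @ \oo --> 0%E].

Section Trading.
Context {R : realType}.
(* p i is the realized forecast and q i the realized signal at step i, that is,
   the randomized version of the price S (i - 1). *)
Variables (eps : R) (p q S : nat -> R).

Definition entry (i : nat) : R := (q i + eps < p i)%R%:R.

Definition gambles (n : nat) : R := \sum_(1 <= i < n.+1) entry i.

Definition total_gain (n : nat) : R :=
  \sum_(1 <= i < n.+1) entry i * (S i - S i.-1).

Definition average_income (n : nat) : R := total_gain n / gambles n.

End Trading.

(* Main.v *)
(** Forecasts and signals are rounded at random to the two neighbouring points
    of the grid of mesh 1/m, where m = 2^k during the phase 16^k <= i < 16^(k+1),
    so that m is about i^(1/4). In each phase the forecaster records, for every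
    cell of the grid of pairs (forecast, signal), the sum of the past errors
    weighted by the probability of being rounded to that cell, and chooses p_i by
    the intermediate value theorem so that, whatever the outcome, the inner
    product of this vector with its next increment is nonpositive. Its squared
    norm is then at most n and, by Cauchy-Schwarz over the (m+1)^2 cells, the
    conditional means of chi(p~_i, x~_i) (S_i - p~_i) add up to O(m sqrt n + n/m)
    = O(n^(3/4)) for every set at once. The randomized sum deviates from its mean
    by 4 n^(3/4) with probability at most exp(- sqrt n / 2) (Chernoff), which
    gives calibration by Borel-Cantelli, and the income bound by applying it to
    the entry rule itself. Since the phases grow geometrically there is no loss
    between phases, and n^(3/4) suffices in place of n^(3/4 + nu). *)

Require Import Defs.
From HB Require Import structures.
From mathcomp Require Import all_boot all_order all_algebra.
From mathcomp Require Import all_classical all_reals all_analysis.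
From mathcomp Require Import measurable_realfun.
From mathcomp Require Import lra ring zify.

Set Implicit Arguments.
Unset Strict Implicit.
Unset Printing Implicit Defensive.

Import Order.TTheory GRing.Theory Num.Theory.
Import numFieldNormedType.Exports.

Local Open Scope classical_set_scope.
Local Open Scope ring_scope.

(** * Hat functions and random rounding to a grid *)

Section Hat.
Context {R : realType}.
Implicit Types (y z t : R) (a m N : nat).

(** The tent function. It is continuous, which makes the forecaster's equation solvable, and its
    integer translates reproduce affine functions, which makes rounding unbiased. *)
Definition hat z : R := Num.max 0 (1 - `|z|).

Lemma hat_ge0 z : 0 <= hat z.
Proof. by rewrite /hat le_max lexx. Qed.

Lemma hat_le1 z : hat z <= 1.
Proof. by rewrite /hat ge_max ler01 gerBl normr_ge0. Qed.

Lemma hat_eq0 z : 1 <= `|z| -> hat z = 0.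
Proof. by move=> z1; apply/max_idPl; rewrite subr_le0. Qed.

Lemma hat_neq0 z : hat z != 0 -> `|z| < 1.
Proof. by apply: contraNT; rewrite -leNgt => /hat_eq0 ->. Qed.

Lemma hat_continuous : continuous hat.
Proof.
move=> z; apply: (@continuous_max _ _ (cst 0) (fun z => 1 - `|z|)).
  exact: cst_continuous.
by apply: continuousB; [exact: cst_continuous | exact: norm_continuous].
Qed.

Lemma hat_gt a m z : z <= m%:R -> (m < a)%N -> hat (z - a%:R) = 0.
Proof.
move=> zm ma; apply: hat_eq0; have : m%:R + 1 <= a%:R :> R.
  by rewrite natr1 ler_nat.
by move=> ?; rewrite ler0_norm; lra.
Qed.

(** Induction on [m]: for [z <= m] the new tent vanishes, and beyond [m] only the last two tents are
    nonzero, with heights adding up to 1. *)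
Lemma hat_partition m z : 0 <= z <= m%:R ->
  \sum_(a < m.+1) hat (z - a%:R) = 1 /\
  \sum_(a < m.+1) hat (z - a%:R) * a%:R = z.
Proof.
elim: m => [|m IH] /andP[z0 zm].
  have -> : z = 0 by apply/eqP; rewrite eq_le z0 zm.
  by rewrite !big_ord1 mulr0 subr0 /hat normr0 subr0; split => //; apply/max_idPr.
rewrite -natr1 in zm; case: (lerP z m%:R) => zm'.
  have [e1 e2] := IH (introT andP (conj z0 zm')).
  rewrite 2!(big_ord_recr m.+1) /= e1 e2 (@hat_gt m.+1 m)//.
  by rewrite mul0r !addr0.
have e a : (a < m)%N -> hat (z - a%:R) = 0.
  move=> am; apply: hat_eq0; have : a%:R + 1 <= m%:R :> R.
    by rewrite natr1 ler_nat.
  by move=> ?; rewrite ger0_norm; lra.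
rewrite 2!(big_ord_recr m.+1) 2!(big_ord_recr m) /=.
rewrite big1 ?add0r; last by move=> i _; rewrite e.
rewrite big1 ?add0r; last by move=> i _; rewrite e ?mul0r.
have -> : hat (z - m%:R) = 1 - (z - m%:R).
  by rewrite /hat ger0_norm ?subr_ge0 ?(ltW zm')//; apply/max_idPr; lra.
have -> : hat (z - m.+1%:R) = z - m%:R.
  rewrite /hat -natr1 ler0_norm; last lra.
  by rewrite (_ : 1 - _ = z - m%:R); [apply/max_idPr | ]; lra.
rewrite -natr1; split; ring.
Qed.

Definition wgt m y a : R := hat (m%:R * y - a%:R).

Lemma wgt_ge0 m y a : 0 <= wgt m y a. Proof. exact: hat_ge0. Qed.

Lemma wgt_le1 m y a : wgt m y a <= 1. Proof. exact: hat_le1. Qed.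

Lemma scaled_itv m y : 0 <= y <= 1 -> 0 <= m%:R * y <= m%:R.
Proof.
by move=> /andP[y0 y1]; rewrite mulr_ge0//= ler_piMr.
Qed.

Lemma wgt_gt m y a : 0 <= y <= 1 -> (m < a)%N -> wgt m y a = 0.
Proof. by move=> /(@scaled_itv m)/andP[_ ym] /(hat_gt ym). Qed.

Lemma sum_wgt m y : 0 <= y <= 1 -> \sum_(a < m.+1) wgt m y a = 1.
Proof. by move=> /(@scaled_itv m)/hat_partition[]. Qed.

Lemma mean_wgt m y : (0 < m)%N -> 0 <= y <= 1 ->
  \sum_(a < m.+1) wgt m y a * (a%:R / m%:R) = y.
Proof.
move=> m0 /(@scaled_itv m)/hat_partition[_ e].
under eq_bigr do rewrite mulrA.
by rewrite -mulr_suml e mulrC mulKf// pnatr_eq0 -lt0n.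
Qed.

Lemma wgt_near m y a : (0 < m)%N -> wgt m y a != 0 ->
  `|y - a%:R / m%:R| <= m%:R^-1.
Proof.
move=> m0 /hat_neq0/ltW; have m0' : 0 < m%:R :> R by rewrite ltr0n.
move=> h; rewrite -(ler_pM2l m0') mulfV ?gt_eqF//.
rewrite -[X in X * _](gtr0_norm m0') -normrM mulrBr.
by rewrite [m%:R * (_ / _)]mulrCA mulfV ?gt_eqF// mulr1.
Qed.

(** Lets grids of different meshes share one index range, since the surplus indices have weight
    0. *)
Lemma sum_wgt_widen m N y (F : nat -> R) : 0 <= y <= 1 -> (m < N)%N ->
  \sum_(a < N) wgt m y a * F a = \sum_(a < m.+1) wgt m y a * F a.
Proof.
move=> y01 mN; rewrite [RHS](big_ord_widen N (fun a => wgt m y a * F a))//.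
rewrite [RHS]big_mkcond; apply: eq_bigr => a _; case: ltnP => // ma.
by rewrite wgt_gt// mul0r.
Qed.

End Hat.

(** * Random rounding as a probability measure *)

Section GridLaw.
Context {R : realType}.
Implicit Types (y : R) (m a : nat).

Definition clamp y : R := Num.max 0 (Num.min 1 y).

Lemma clamp_itv y : 0 <= clamp y <= 1.
Proof. by rewrite /clamp le_max lexx/= ge_max ler01 ge_min lexx. Qed.

Lemma clamp_id y : 0 <= y <= 1 -> clamp y = y.
Proof.
move=> /andP[y0 y1].
by rewrite /clamp (min_idPr y1) (max_idPr y0).
Qed.

(* Clamping makes the total mass equal to 1 also for the values y outside
   [0, 1], for which randomization methods are unconstrained. *)
Definition grid_atom m y a : {measure set R -> \bar R} :=
  mscale (NngNum (wgt_ge0 m (clamp y) a)) (dirac (a%:R / m%:R : R)).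

Definition grid_law m y : set R -> \bar R := msum (grid_atom m y) m.+1.

HB.instance Definition _ m y :=
  Measure.copy (grid_law m y) (msum (grid_atom m y) m.+1).

Lemma grid_lawE m y (B : set R) :
  grid_law m y B = (\sum_(a < m.+1) wgt m (clamp y) a * \1_B (a%:R / m%:R))%:E.
Proof.
rewrite /grid_law /msum -sumEFin; apply: eq_bigr => a _.
by rewrite /grid_atom /= /mscale /= diracE EFinM indicE.
Qed.

Lemma grid_law_setT m y : grid_law m y setT = 1%E.
Proof.
rewrite grid_lawE; under eq_bigr do rewrite indicT mulr1.
by rewrite sum_wgt// clamp_itv.
Qed.

HB.instance Definition _ m y :=
  Measure_isProbability.Build _ _ _ (grid_law m y) (grid_law_setT m y).

Lemma ge0_integral_grid_law m y (f : R -> \bar R) :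
  (forall u, 0 <= f u)%E -> measurable_fun setT f ->
  (integral (grid_law m y) setT f =
   \sum_(a < m.+1) (wgt m (clamp y) a)%:E * f (a%:R / m%:R)%R)%E.
Proof.
move=> f0 mf; rewrite /grid_law ge0_integral_measure_sum//.
apply: eq_bigr => a _; rewrite /grid_atom ge0_integral_mscale//.
by rewrite integral_dirac// diracT mul1e.
Qed.

Lemma grid_law_mean m y : (0 < m)%N -> 0 <= y <= 1 ->
  ('E_(grid_law m y)[fun u => u] = y%:E)%E.
Proof.
move=> m0 y01; rewrite unlock integralE.
have mE : measurable_fun setT (@EFin R) by apply/measurable_EFinP; exact: measurable_id.
rewrite ge0_integral_grid_law//; last exact: measurable_funepos.
rewrite ge0_integral_grid_law//; last exact: measurable_funeneg.
(* All grid points are nonnegative, so the negative part contributes nothing. *)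
rewrite [X in (_ - X)%E]big1 ?sube0; last first.
  move=> a _; rewrite funenegE (_ : maxe _ _ = 0)%E ?mule0//.
  by apply/max_idPr; rewrite -EFinN lee_fin oppr_le0 divr_ge0.
rewrite clamp_id// -[in RHS](mean_wgt m0 y01) -sumEFin; apply: eq_bigr => a _.
rewrite funeposE (_ : maxe _ _ = (a%:R / m%:R)%:E)//.
by apply/max_idPl; rewrite lee_fin divr_ge0.
Qed.

Lemma grid_law_set1 m y a : (0 < m)%N -> 0 <= y <= 1 ->
  grid_law m y [set a%:R / m%:R] = (wgt m y a)%:E.
Proof.
move=> m0 y01; rewrite grid_lawE clamp_id//; congr EFin.
have m0' : m%:R != 0 :> R by rewrite pnatr_eq0 -lt0n.
have e (b : nat) : \1_[set a%:R / m%:R] (b%:R / m%:R : R) = (b == a)%:R :> R.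
  rewrite indicE; congr (_%:R); congr nat_of_bool.
  apply/idP/eqP => [/set_mem/= /(mulIf (invr_neq0 m0'))/eqP|->].
    by rewrite eqr_nat => /eqP.
  by rewrite mem_set.
under eq_bigr do rewrite e.
case: (ltnP a m.+1) => am.
  rewrite (bigD1 (Ordinal am))//= eqxx mulr1 big1 ?addr0// => i /eqP ia.
  by case: eqP => [ai|]; rewrite ?mulr0//; case: ia; exact/val_inj.
rewrite wgt_gt// big1// => i _; case: eqP => [ia|]; last by rewrite mulr0.
by move: (ltn_ord i); rewrite ia ltnNge am.
Qed.

Lemma grid_law_near m y (B : set R) : (0 < m)%N -> 0 <= y <= 1 ->
  (forall a, (a <= m)%N -> `|y - a%:R / m%:R| <= m%:R^-1 -> ~ B (a%:R / m%:R)) ->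
  grid_law m y B = 0%E.
Proof.
move=> m0 y01 h; rewrite grid_lawE clamp_id// big1// => a _.
have [->|w0] := eqVneq (wgt m y a) 0; first by rewrite mul0r.
rewrite indicE memNset ?mulr0//; apply: h; first by rewrite -ltnS.
exact: wgt_near.
Qed.

Lemma grid_law_itv m y : (0 < m)%N -> 0 <= y <= 1 ->
  grid_law m y `[0, 1]%classic = 1%E.
Proof.
move=> m0 y01; rewrite grid_lawE.
under eq_bigr => a _.
  rewrite indicE mem_set ?mulr1; first over.
  rewrite /= in_itv/= divr_ge0//= ler_pdivrMr ?ltr0n// mul1r ler_nat.
  by rewrite -ltnS.
by rewrite sum_wgt ?clamp_itv.
Qed.

End GridLaw.

(** * The forecasting algorithm *)

Section FourthRoot.
Context {R : realType}.
Implicit Types (i k n : nat).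

Definition root4 n : R := Num.sqrt (Num.sqrt n%:R).

Lemma root4_ge0 n : 0 <= root4 n. Proof. exact: sqrtr_ge0. Qed.

Lemma root4_gt0 n : (0 < n)%N -> 0 < root4 n.
Proof. by move=> n0; rewrite !sqrtr_gt0 ltr0n. Qed.

Lemma root4_sqr n : root4 n ^+ 2 = Num.sqrt n%:R.
Proof. by rewrite sqr_sqrtr// sqrtr_ge0. Qed.

Lemma root4_pow4 n : root4 n ^+ 4 = n%:R.
Proof. by rewrite (exprM _ 2 2) root4_sqr sqr_sqrtr. Qed.

Lemma root4_ge1 n : (0 < n)%N -> 1 <= root4 n.
Proof.
move=> n0; rewrite -(@ler_pXn2r _ 4)// ?nnegrE ?root4_ge0//.
by rewrite root4_pow4 expr1n ler1n.
Qed.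

Definition phase i : nat := trunc_log 16 i.

Definition mesh i : nat := 2 ^ phase i.

Lemma mesh_gt0 i : (0 < mesh i)%N. Proof. by rewrite expn_gt0. Qed.

Lemma mesh_le i : (0 < i)%N -> (mesh i)%:R <= root4 i.
Proof.
move=> i0; rewrite -(@ler_pXn2r _ 4)// ?nnegrE ?root4_ge0//.
rewrite root4_pow4 -natrX ler_nat /mesh -expnM mulnC expnM.
exact: trunc_logP.
Qed.

Lemma mesh_ge i : root4 i <= 2 * (mesh i)%:R.
Proof.
rewrite -(@ler_pXn2r _ 4)// ?nnegrE ?root4_ge0//.
rewrite root4_pow4 -natrM -natrX ler_nat /mesh -expnS -expnM mulnC expnM.
exact/ltnW/trunc_log_ltn.
Qed.

Lemma mesh_inv i : (0 < i)%N -> (mesh i)%:R^-1 <= 2 / root4 i.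
Proof.
move=> i0; rewrite ler_pdivlMr ?root4_gt0// mulrC ler_pdivrMr ?ltr0n ?mesh_gt0//.
exact: mesh_ge.
Qed.

(** The increments of [4 n^(3/4)] dominate [2 / n^(1/4)], which bounds the inverse mesh. *)
Lemma sum_mesh_inv n : \sum_(i < n) (mesh i.+1)%:R^-1 <= 4 * root4 n ^+ 3.
Proof.
elim: n => [|n IH]; first by rewrite big_ord0 mulr_ge0// exprn_ge0// root4_ge0.
rewrite big_ord_recr/=; apply: le_trans (lerD IH (mesh_inv (ltn0Sn n))) _.
have s0 := root4_gt0 (ltn0Sn n); have r0 := root4_ge0 n.
have := root4_pow4 n.+1; have := root4_pow4 n; rewrite -natr1.
move: (root4 n) (root4 n.+1) s0 r0 => r s s0 r0 <- e.
have rs : r <= s by rewrite -(@ler_pXn2r _ 4)// ?nnegrE ?(ltW s0)// e; lra.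
rewrite -lerBrDl ler_pdivrMr//.
(* Since [s^4 - r^4 = 1], the claim becomes homogeneous in [r <= s]. *)
have -> : 2 = 2 * (s ^+ 4 - r ^+ 4) by rewrite e; ring.
rewrite -subr_ge0.
rewrite (_ : _ - _ = 2 * ((s - r) * ((s - r) * (s ^+ 2 + r ^+ 2) +
  2 * s * r * s))); last by ring.
apply: mulr_ge0 => //; apply: mulr_ge0; first by rewrite subr_ge0.
apply: addr_ge0; last by rewrite !mulr_ge0 ?(ltW s0).
by rewrite mulr_ge0 ?subr_ge0// addr_ge0 ?sqr_ge0.
Qed.

(** The Cauchy-Schwarz factors of the phases grow geometrically, so their sum is of the order of the
    last one. *)
Lemma sum_pow2 k : \sum_(j < k.+1) ((2 ^ j).+1)%:R <= 4 * (2 ^ k)%:R :> R.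
Proof.
rewrite -natr_sum -natrM ler_nat; elim: k => [|k IH].
  by rewrite big_ord1.
rewrite big_ord_recr /= (leq_trans (leq_add IH (leqnn _)))//.
by have : (0 < 2 ^ k)%N := expn_gt0 2 k; rewrite expnS; lia.
Qed.

End FourthRoot.

(** * The forecaster and its imbalance vectors *)

Section Algorithm.
Context {R : realType}.
Implicit Types (S x : nat -> R) (mu : nat -> nat -> nat -> R).
Implicit Types (y s : R) (a b j k m n : nat).

Definition cell m y s (c : 'I_m.+1 * 'I_m.+1) : R := wgt m y c.1 * wgt m s c.2.

Lemma cell_ge0 m y s c : 0 <= @cell m y s c.
Proof. by rewrite mulr_ge0 ?wgt_ge0. Qed.

Lemma cell_le1 m y s c : @cell m y s c <= 1.
Proof. by rewrite mulr_ile1 ?wgt_ge0 ?wgt_le1. Qed.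

Lemma sum_cell m y s : 0 <= y <= 1 -> 0 <= s <= 1 ->
  \sum_c @cell m y s c = 1.
Proof.
move=> y01 s01.
rewrite -(pair_big xpredT xpredT (fun a b : 'I_m.+1 => wgt m y a * wgt m s b))/=.
by rewrite -big_distrlr/= !sum_wgt// mulr1.
Qed.

Definition drift mu k s y : R :=
  \sum_(c : 'I_(2 ^ k).+1 * 'I_(2 ^ k).+1) mu k c.1 c.2 * cell y s c.

Lemma drift_continuous mu k s : continuous (drift mu k s).
Proof.
apply: continuous_big => [|c _ y]; first exact: add_continuous.
apply: cvgM; first exact: cvg_cst.
apply: cvgM; last exact: cvg_cst.
rewrite /wgt; apply: (@continuous_comp _ _ _ (fun y => (2 ^ k)%:R * y - c.1%:R) hat).
  by apply: cvgB; [apply: cvgM; [exact: cvg_cst | exact: cvg_id] | exact: cvg_cst].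
exact: hat_continuous.
Qed.

(** [drift mu k s y * (u - y)] is the inner product of the imbalance vector with its increment if
    [y] is forecast and the outcome is [u]. *)
Definition defensive mu k s : set R :=
  [set y | 0 <= y <= 1 /\
    forall u, 0 <= u <= 1 -> drift mu k s y * (u - y) <= 0].

(** The forecast 0 works if the drift there is nonpositive, and 1 works if the drift there is
    nonnegative. Otherwise the continuous drift changes sign and has a zero. *)
Lemma defensive_nonempty mu k s : defensive mu k s !=set0.
Proof.
pose f := drift mu k s.
have [f0|f0] := lerP (f 0) 0.
  exists 0; split; rewrite ?lexx ?ler01// => u /andP[u0 _].
  by rewrite subr0 mulr_le0_ge0.
have [f1|f1] := lerP 0 (f 1).
  exists 1; split; rewrite ?lexx ?ler01// => u /andP[_ u1].
  by rewrite mulr_ge0_le0// subr_le0.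
have [] := @IVT R f 0 1 0 ler01.
- by apply: continuous_subspaceT; exact: drift_continuous.
- by rewrite ge_min le_max (ltW f0) (ltW f1) orbT.
- move=> y; rewrite in_itv/= => y01 fy; exists y; split => // u _.
  by rewrite -/f fy mul0r.
Qed.

Definition pick_forecast mu k s : R := xget 0 (defensive mu k s).

Lemma pick_forecastP mu k s : defensive mu k s (pick_forecast mu k s).
Proof. by case: (defensive_nonempty mu k s) => y; exact: xgetI. Qed.

Fixpoint state S x n : R * (nat -> nat -> nat -> R) :=
  if n is n'.+1 then
    let mu := (state S x n').2 in
    let k := phase n in
    let p := pick_forecast mu k (x n) in
    (p, fun j a b => mu j a b +
      if j == k then wgt (2 ^ k) p a * wgt (2 ^ k) (x n) b * (S n - p) else 0)
  else (0, fun _ _ _ => 0).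

Definition fcast S x n : R := (state S x n).1.

(* The imbalance of the cell (a, b) of the grid of the phase k: the sum, over
   the past steps of that phase, of the errors weighted by the probability of
   being rounded to that cell. *)
Definition imbalance S x n : nat -> nat -> nat -> R := (state S x n).2.

Lemma imbalanceS S x n k a b : imbalance S x n.+1 k a b = imbalance S x n k a b +
  if k == phase n.+1 then
    wgt (mesh n.+1) (fcast S x n.+1) a * wgt (mesh n.+1) (x n.+1) b *
      (S n.+1 - fcast S x n.+1)
  else 0.
Proof. by []. Qed.

Lemma fcastP S x n :
  defensive (imbalance S x n) (phase n.+1) (x n.+1) (fcast S x n.+1).
Proof. exact: pick_forecastP. Qed.

Lemma fcast_itv S x n : 0 <= fcast S x n <= 1.
Proof.
case: n => [|n]; first by rewrite lexx ler01.
exact: (proj1 (pick_forecastP _ _ _)).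
Qed.

Lemma eq_state S S' x x' n :
  (forall i, (0 < i <= n)%N -> S i = S' i /\ x i = x' i) ->
  state S x n = state S' x' n.
Proof.
elim: n => // n IH h /=; rewrite IH; last first.
  by move=> i /andP[i0 ni]; apply: h; rewrite i0 leqW.
by have [-> ->] := h n.+1 (ltnSn n).
Qed.

(** Causality: it allows the recursion on infinite sequences to be evaluated on the finite lists
    given to a forecasting algorithm. *)
Lemma eq_fcast S S' x x' n :
  (forall i, (0 < i < n)%N -> S i = S' i) ->
  (forall i, (0 < i <= n)%N -> x i = x' i) ->
  fcast S x n = fcast S' x' n.
Proof.
case: n => // n hS hx; rewrite /fcast /= (@eq_state S S' x x').
  by rewrite hx// ltnSn.
by move=> i /andP[i0 ni]; rewrite hS ?hx// i0// leqW.
Qed.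

Definition rule (s x : seq R) : R :=
  fcast (nth 0 (0 :: s)) (nth 0 (0 :: x)) (size x).

Lemma rule_itv (s x : seq R) : size x = (size s).+1 ->
  (forall u, u \in s -> 0 <= u <= 1) -> (forall u, u \in x -> 0 <= u <= 1) ->
  0 <= rule s x <= 1.
Proof. by move=> *; exact: fcast_itv. Qed.

Definition algorithm := ForecastingAlgorithm rule_itv.

Lemma forecast_algorithm S x n : forecast algorithm S x n = fcast S x n.
Proof.
rewrite /forecast /= /rule size_map size_iota; apply: eq_fcast => [] [//|i] /= h.
  by rewrite (nth_map 0%N) ?nth_iota ?size_iota//; lia.
by rewrite (nth_map 0%N) ?nth_iota ?size_iota.
Qed.

Lemma imbalanceE S x n k a b : imbalance S x n k a b =
  \sum_(i < n | phase i.+1 == k) wgt (2 ^ k) (fcast S x i.+1) a *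
    wgt (2 ^ k) (x i.+1) b * (S i.+1 - fcast S x i.+1).
Proof.
elim: n => [|n IH]; first by rewrite big_ord0.
rewrite big_mkcond big_ord_recr /= -big_mkcond -IH /imbalance /= eq_sym.
by case: eqP => // <-.
Qed.

Section Bounds.
Variables S x : nat -> R.
Hypothesis S01 : forall i, (0 < i)%N -> 0 <= S i <= 1.
Hypothesis x01 : forall i, (0 < i)%N -> 0 <= x i <= 1.

(** In a step of phase [k] the cross term is nonpositive by the choice of the forecast, and the
    squared norm of the increment is at most 1. *)
Lemma sum_sqr_imbalance n k :
  \sum_(c : 'I_(2 ^ k).+1 * 'I_(2 ^ k).+1) imbalance S x n k c.1 c.2 ^+ 2 <= n%:R.
Proof.
elim: n => [|n IH]; first by rewrite big1// => c _; rewrite expr0n.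
under eq_bigr do rewrite imbalanceS.
case: eqP => [kE|_]; last first.
  by under eq_bigr do rewrite addr0; rewrite (le_trans IH)// ler_nat.
have [p01 /(_ (S n.+1) (S01 (ltn0Sn n)))] := fcastP S x n.
rewrite /mesh -kE; set p := fcast _ _ _ in p01 *; set d := _ - p => dr.
under eq_bigr do rewrite -/(cell p (x n.+1) _) sqrrD exprMn mulrA.
rewrite !big_split /=.
rewrite -!mulr_suml -/(drift _ _ _ _) -natr1 lerD//.
  by rewrite -[leRHS]addr0 lerD// -[leRHS]addr0 lerD.
(* The weights lie in [0, 1], so their squares add up to at most their sum, which is 1. *)
rewrite mulr_ile1 ?sqr_ge0 ?sumr_ge0// => [c _||]; first exact: sqr_ge0.
  rewrite -(sum_cell (2 ^ k) p01 (x01 (ltn0Sn n))) ler_sum// => c _.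
  by rewrite expr2 ler_piMr ?cell_ge0 ?cell_le1.
rewrite /d -[_ ^+ 2]real_normK ?num_real// expr_le1// ler_norml.
by have := S01 (ltn0Sn n); lra.
Qed.

Lemma sum_abs_imbalance n k :
  \sum_(c : 'I_(2 ^ k).+1 * 'I_(2 ^ k).+1) `|imbalance S x n k c.1 c.2| <=
  (2 ^ k).+1%:R * Num.sqrt n%:R.
Proof.
(* The case [n = 0] is apart because the factor [t] below has to be positive. *)
case: n => [|n]; first by rewrite big1 ?sqrtr0 ?mulr0// => c _; rewrite normr0.
have := sum_sqr_imbalance n.+1 k; set m := (2 ^ k).+1; set u := imbalance _ _ _.
set s := Num.sqrt _ => h; have s0 : 0 < s by rewrite sqrtr_gt0 ltr0n.
have sE : s ^+ 2 = n.+1%:R by rewrite sqr_sqrtr.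
have m0 : 0 < m%:R :> R by rewrite ltr0n.
have t0 : 0 < s / m%:R by rewrite divr_gt0.
(* Cauchy-Schwarz in the form 2 t |u| <= u^2 + t^2, at t = s / m *)
rewrite -(ler_pM2l t0) -(ler_pM2l (ltr0n R 2)) 2!mulr_sumr.
apply: le_trans (_ : \sum_(c : 'I_m * 'I_m) (u k c.1 c.2 ^+ 2 + (s / m%:R) ^+ 2) <= _).
  apply: ler_sum => c _; rewrite -[u _ _ _ ^+ 2]real_normK ?num_real// -subr_ge0.
  by rewrite (_ : _ - _ = (s / m%:R - `|u k c.1 c.2|) ^+ 2) ?sqr_ge0//; ring.
rewrite big_split /= sumr_const card_prod card_ord -[_ *+ (m * m)]mulr_natl natrM.
rewrite -sE in h; apply: le_trans (lerD h (lexx _)) _.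
rewrite le_eqVlt; apply/orP; left; apply/eqP.
by field; rewrite gt_eqF.
Qed.

(** The error [S_i - a/m] is [S_i - p_i] plus [p_i - a/m]. The first part adds up to the imbalances
    tested against [G], the second is at most [1/m] per step. Each contributes [4 n^(3/4)]. *)
Lemma conditional_mean_le (G : R -> R -> R) n :
  (forall u v, `|G u v| <= 1) ->
  `|\sum_(i < n) \sum_(c : 'I_(mesh i.+1).+1 * 'I_(mesh i.+1).+1)
     cell (fcast S x i.+1) (x i.+1) c *
       (G (c.1%:R / (mesh i.+1)%:R) (c.2%:R / (mesh i.+1)%:R) *
         (S i.+1 - c.1%:R / (mesh i.+1)%:R))| <= 8 * root4 n ^+ 3.
Proof.
move=> G1; case: n => [|n].
  by rewrite big_ord0 normr0 mulr_ge0// exprn_ge0// root4_ge0.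
pose g k (c : 'I_(2 ^ k).+1 * 'I_(2 ^ k).+1) :=
  G (c.1%:R / (2 ^ k)%:R) (c.2%:R / (2 ^ k)%:R).
pose p := fcast S x.
rewrite (_ : \sum_(i < n.+1) _ =
    \sum_(k < (phase n.+1).+1) \sum_c g k c * imbalance S x n.+1 k c.1 c.2 +
    \sum_(i < n.+1) \sum_c cell (p i.+1) (x i.+1) c *
       (g (phase i.+1) c * (p i.+1 - c.1%:R / (mesh i.+1)%:R))).
  have -> : 8 * root4 n.+1 ^+ 3 =
      4 * root4 n.+1 * Num.sqrt n.+1%:R + 4 * root4 n.+1 ^+ 3 :> R.
    by rewrite -root4_sqr; ring.
  rewrite (le_trans (ler_normD _ _))// lerD//.
    rewrite (le_trans (ler_norm_sum _ _ _))//.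
    apply: (@le_trans _ _ (\sum_(k < (phase n.+1).+1)
        (2 ^ k).+1%:R * Num.sqrt n.+1%:R)).
      apply: ler_sum => k _; apply: le_trans (sum_abs_imbalance n.+1 k).
      rewrite (le_trans (ler_norm_sum _ _ _))// ler_sum// => c _.
      by rewrite normrM ler_piMl ?G1.
    rewrite -mulr_suml ler_wpM2r ?sqrtr_ge0// (le_trans (sum_pow2 _))//.
    by rewrite ler_wpM2l// mesh_le.
  rewrite (le_trans _ (sum_mesh_inv _))// (le_trans (ler_norm_sum _ _ _))//.
  apply: ler_sum => i _; rewrite (le_trans (ler_norm_sum _ _ _))//.
  rewrite -[leRHS]mul1r.
  rewrite -[X in _ <= X * _](sum_cell (mesh i.+1) (fcast_itv S x i.+1) (x01 (ltn0Sn i))).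
  rewrite mulr_suml ler_sum// => c _; rewrite normrM ger0_norm ?cell_ge0//.
  (* Only cells next to the forecast have positive weight, and there the rounding error is at most
     one mesh width. *)
  have [->|c0] := eqVneq (cell (fcast S x i.+1) (x i.+1) c) 0; first by rewrite !mul0r.
  rewrite ler_wpM2l ?cell_ge0// normrM -[leRHS]mul1r ler_pM//; first exact: G1.
  apply: wgt_near; first exact: mesh_gt0.
  by apply: contraNN c0 => /eqP c0; rewrite /cell c0 mul0r.
pose Y (i : nat) k := \sum_c cell (p i.+1) (x i.+1) c * (g k c * (S i.+1 - p i.+1)).
(* Regrouping by time: step [i] enters the imbalance of its own phase only. *)
have -> : \sum_(k < (phase n.+1).+1) \sum_c g k c * imbalance S x n.+1 k c.1 c.2 =
    \sum_(i < n.+1) Y i (phase i.+1).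
  transitivity (\sum_(k < (phase n.+1).+1) \sum_(i < n.+1 | phase i.+1 == k) Y i k).
    apply: eq_bigr => k _; rewrite /Y exchange_big; apply: eq_bigr => c _.
    rewrite imbalanceE mulr_sumr; apply: eq_bigr => i _.
    by rewrite /cell /p; ring.
  rewrite (exchange_big_dep xpredT)//=; apply: eq_bigr => i _.
  rewrite (eq_bigl (fun k : 'I_(phase n.+1).+1 => k == phase i.+1 :> nat)) ?big_ord1_eq.
    by rewrite ltnS leq_trunc_log.
  by move=> k; rewrite eq_sym.
rewrite -big_split; apply: eq_bigr => i _; rewrite -big_split; apply: eq_bigr => c _ /=.
by rewrite /g -/(mesh _) /p; ring.
Qed.

End Bounds.
End Algorithm.

(** * Concentration of the randomized sums *)

Section Chernoff.
Context {R : realType}.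

(** From [exp u <= 1 / (1 - u)] and [(1 - u) (1 + u + 2 u^2) = 1 + u^2 (1 - 2 u)]. *)
Lemma expR_le_quad (u : R) : u <= 2^-1 -> expR u <= 1 + u + 2 * u ^+ 2.
Proof.
move=> u2; have u1 : 0 < 1 - u by lra.
have h : 1 - u <= expR (- u) by have := expR_ge1Dx (- u); rewrite addrC.
rewrite expRN in h.
have e0 := expR_gt0 u.
have {}h : (1 - u) * expR u <= 1.
  by rewrite -(ler_pM2r e0) mulVf ?gt_eqF// in h.
rewrite -(ler_pM2l u1) (le_trans h)// -subr_ge0.
rewrite (_ : _ - 1 = u ^+ 2 * (1 - 2 * u)); last by ring.
by rewrite mulr_ge0 ?sqr_ge0//; lra.
Qed.

(** The centred variable is at most 2 in absolute value, so [s <= 1/4] permits the quadratic bound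
    on the exponential. Its linear term averages to 0 and its quadratic term is at most [8 s^2]. *)
Lemma mgf_le (J : finType) (w z : J -> R) (s : R) :
  (forall c, 0 <= w c) -> \sum_c w c = 1 ->
  (forall c, w c != 0 -> `|z c| <= 1) -> 0 <= s <= 4^-1 ->
  \sum_c w c * expR (s * (z c - \sum_c w c * z c)) <= expR (8 * s ^+ 2).
Proof.
move=> w0 w1 z1 /andP[s0 s4]; set e := \sum_c w c * z c.
have e1 : `|e| <= 1.
  rewrite -w1 (le_trans (ler_norm_sum _ _ _))// ler_sum// => c _.
  rewrite normrM ger0_norm//; have [->|wc] := eqVneq (w c) 0; first by rewrite mul0r.
  by rewrite ler_piMr// z1.
apply: (@le_trans _ _ (\sum_c w c * (1 + 8 * s ^+ 2 + s * (z c - e)))).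
  apply: ler_sum => c _; have [->|wc] := eqVneq (w c) 0; first by rewrite !mul0r.
  rewrite ler_wpM2l//; have v2 : `|z c - e| <= 2.
    by rewrite (le_trans (ler_normB _ _))// -[2]/(1 + 1) lerD// z1.
  have sv : s * (z c - e) <= 2^-1.
    apply: le_trans (_ : s * 2 <= _); last lra.
    by rewrite ler_wpM2l// (le_trans (ler_norm _)).
  rewrite (le_trans (expR_le_quad sv))// addrAC lerD2r lerD2l exprMn.
  rewrite mulrCA [leRHS]mulrC ler_wpM2l ?sqr_ge0//.
  rewrite -[_ ^+ 2]real_normK ?num_real//.
  have := normr_ge0 (z c - e); nra.
apply: le_trans (expR_ge1Dx _); rewrite le_eqVlt; apply/orP; left; apply/eqP.
have eE : \sum_c w c * z c = e by [].
clearbody e; transitivity ((1 + 8 * s ^+ 2) * (\sum_c w c) + s * (\sum_c w c * z c) -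
    s * e * \sum_c w c).
  rewrite !mulr_sumr -big_split /= -sumrB; apply: eq_bigr => c _; ring.
by rewrite w1 eE; ring.
Qed.

Lemma chernoff (n : nat) (J : finType) (w z : 'I_n -> J -> R) (s t : R) :
  (forall i c, 0 <= w i c) -> (forall i, \sum_c w i c = 1) ->
  (forall i c, w i c != 0 -> `|z i c| <= 1) -> 0 <= s <= 4^-1 ->
  \sum_(f : {ffun 'I_n -> J} |
      t < \sum_i z i (f i) - \sum_i \sum_c w i c * z i c) \prod_i w i (f i)
  <= expR (n%:R * (8 * s ^+ 2) - s * t).
Proof.
move=> w0 w1 z1 s4; have [s0 _] := andP s4.
pose v i c := z i c - \sum_c w i c * z i c.
(* Exponential Markov inequality: on the event summed over, [exp (s (sum of v - t))] is at least
   1. *)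
apply: (@le_trans _ _ (\sum_(f : {ffun 'I_n -> J})
    expR (- (s * t)) * \prod_i (w i (f i) * expR (s * v i (f i))))).
  rewrite big_mkcond ler_sum// => f _; rewrite big_split /= -expR_sum mulrCA -expRD.
  have p0 : 0 <= \prod_i w i (f i) by apply: prodr_ge0.
  case: ifP => [h|_]; last by rewrite mulr_ge0 ?expR_ge0.
  rewrite ler_peMr// -expR0 ler_expR -mulr_sumr -mulrN -mulrDr mulr_ge0//.
  by rewrite sumrB; lra.
(* Independence: the sum over all [f] of the products is the product of the sums. *)
rewrite -mulr_sumr -(bigA_distr_bigA (fun i c => w i c * expR (s * v i c))).
rewrite addrC expRD ler_wpM2l ?expR_ge0// expRM_natl.
rewrite -[X in _ <= _ ^+ X]card_ord -prodr_const ler_prod// => i _.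
apply/andP; split; last by apply: mgf_le => // c; exact: z1.
by rewrite sumr_ge0// => c _; rewrite mulr_ge0 ?expR_ge0.
Qed.

End Chernoff.

Section GridPoints.
Context {R : realType}.

Definition grid_near (m : nat) (y : R) : set R :=
  \bigcup_(a in [set a | (a <= m)%N /\ `|y - a%:R / m%:R| <= m%:R^-1])
    [set a%:R / m%:R].

Lemma measurable_grid_near m y : measurable (grid_near m y).
Proof. by apply: bigcup_measurable => a _; exact: measurable_set1. Qed.

Lemma grid_law_near_setC m (y : R) : (0 < m)%N -> 0 <= y <= 1 ->
  grid_law m y (~` grid_near m y) = 0%E.
Proof.
by move=> m0 y01; apply: grid_law_near => // a am ya; apply; exists a.
Qed.

End GridPoints.

(** Union bound; measurability is carried along because each use of subadditivity requires it. *)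
Lemma measure_bigsetU_le d (T : measurableType d) (R : realType)
    (P : {measure set T -> \bar R}) (I : Type) (r : seq I) (Q : pred I)
    (A : I -> set T) (p : I -> R) :
  (forall i, Q i -> measurable (A i) /\ (P (A i) <= (p i)%:E)%E) ->
  measurable (\big[setU/set0]_(i <- r | Q i) A i) /\
  (P (\big[setU/set0]_(i <- r | Q i) A i) <= (\sum_(i <- r | Q i) p i)%:E)%E.
Proof.
move=> h; apply: (big_ind2 (fun B e => measurable B /\ (P B <= e%:E)%E)) => //.
- by split; [exact: measurable0 | rewrite measure0].
- move=> B e C f [mB PB] [mC PC]; split; first exact: measurableU.
  by rewrite (le_trans (measureU2 _ _ _))// EFinD leeD.
Qed.

Lemma subset_bigsetU_fin (T : Type) (I : finType) (Q : pred I) (A : I -> set T) i :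
  Q i -> A i `<=` \big[setU/set0]_(j | Q j) A j.
Proof. by move=> Qi; rewrite (bigD1 i)//= => w; left. Qed.

(** * Tail bound for the rounded forecasts and signals *)

Section Rounding.
Context {R : realType} {d : measure_display} {T : measurableType d}.
Variables (P : probability T R) (p x : nat -> R) (pt xt : nat -> {RV P >-> R}).
Hypothesis p01 : forall i, (0 < i)%N -> 0 <= p i <= 1.
Hypothesis x01 : forall i, (0 < i)%N -> 0 <= x i <= 1.
Hypothesis pt_law :
  forall i, (0 < i)%N -> has_law (pt i) (grid_law (mesh i) (p i)).
Hypothesis xt_law :
  forall i, (0 < i)%N -> has_law (xt i) (grid_law (mesh i) (x i)).

Let X (j : nat + nat) : {RV P >-> R} :=
  match j with inl i => pt i.+1 | inr i => xt i.+1 end.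

Hypothesis indep : mutually_independent X.

Definition off_grid (i : nat) : set T :=
  pt i @^-1` (~` grid_near (mesh i) (p i)) `|`
  xt i @^-1` (~` grid_near (mesh i) (x i)).

Lemma off_grid_null i : (0 < i)%N ->
  measurable (off_grid i) /\ (P (off_grid i) <= 0%:E)%E.
Proof.
move=> i0; have mC m (y : R) : measurable (~` grid_near m y).
  by apply: measurableC; exact: measurable_grid_near.
have m1 : measurable (pt i @^-1` (~` grid_near (mesh i) (p i))).
  by rewrite -[X in measurable X]setTI; exact: measurable_funP.
have m2 : measurable (xt i @^-1` (~` grid_near (mesh i) (x i))).
  by rewrite -[X in measurable X]setTI; exact: measurable_funP.
split; first exact: measurableU.
have e1 : (P (pt i @^-1` (~` grid_near (mesh i) (p i))) <= 0)%E.
  rewrite le_eqVlt; apply/orP; left; apply/eqP.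
  by apply: etrans (pt_law i0 (mC _ _)) _; apply: grid_law_near_setC; rewrite ?mesh_gt0 ?p01.
have e2 : (P (xt i @^-1` (~` grid_near (mesh i) (x i))) <= 0)%E.
  rewrite le_eqVlt; apply/orP; left; apply/eqP.
  by apply: etrans (xt_law i0 (mC _ _)) _; apply: grid_law_near_setC; rewrite ?mesh_gt0 ?x01.
apply: le_trans (measureU2 _ m1 m2) _; apply: le_trans (leeD e1 e2) _.
by rewrite adde0.
Qed.

(** One intersection over [nat + nat], so that [mutually_independent] applies to it directly. The
    default cell of [oapp] is never reached, as the listed indices are below [n]. *)
Definition atom n N (f : {ffun 'I_n -> 'I_N.+1 * 'I_N.+1}) : set T :=
  \bigcap_(j in [set` [seq inl (val i) | i <- enum 'I_n] ++
                      [seq inr (val i) | i <- enum 'I_n]])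
    X j @^-1` (match j with
      | inl i => [set ((oapp f (ord0, ord0) (insub i)).1)%:R / (mesh i.+1)%:R]
      | inr i => [set ((oapp f (ord0, ord0) (insub i)).2)%:R / (mesh i.+1)%:R]
      end).

Lemma atomP n N (f : {ffun 'I_n -> 'I_N.+1 * 'I_N.+1}) w :
  (forall i : 'I_n, pt i.+1 w = (f i).1%:R / (mesh i.+1)%:R /\
                    xt i.+1 w = (f i).2%:R / (mesh i.+1)%:R) ->
  atom f w.
Proof.
move=> h j /=; rewrite mem_cat => /orP[] /mapP[i _ ->] /=; rewrite valK /=.
  exact: (proj1 (h i)).
exact: (proj2 (h i)).
Qed.

Lemma measurable_atom n N (f : {ffun 'I_n -> 'I_N.+1 * 'I_N.+1}) :
  measurable (atom f).
Proof.
apply: fin_bigcap_measurable => [|[i|i] _]; first exact: finite_seq.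
all: by rewrite -[X in measurable X]setTI; apply: measurable_funP => //;
  exact: measurable_set1.
Qed.

Lemma prob_atom n N (f : {ffun 'I_n -> 'I_N.+1 * 'I_N.+1}) :
  P (atom f) = (\prod_(i < n) (wgt (mesh i.+1) (p i.+1) (f i).1 *
                         wgt (mesh i.+1) (x i.+1) (f i).2))%:E.
Proof.
rewrite indep; first last.
- by case=> i; exact: measurable_set1.
- have inl_inj : injective (fun i : 'I_n => inl (val i) : nat + nat).
    by move=> i j [] ij; exact: val_inj.
  have inr_inj : injective (fun i : 'I_n => inr (val i) : nat + nat).
    by move=> i j [] ij; exact: val_inj.
  rewrite cat_uniq (map_inj_uniq inl_inj) (map_inj_uniq inr_inj) enum_uniq andbT /=.
  by apply/hasPn => _ /mapP[i _ ->]; apply/mapP => -[].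
rewrite big_cat big_split /= EFinM -!prodEFin.
congr (_ * _)%E; rewrite big_map big_enum; apply: eq_big => // i _; rewrite valK /=.
  apply: etrans (pt_law (ltn0Sn i) (measurable_set1 _)) _.
  by apply: grid_law_set1; rewrite ?mesh_gt0 ?p01.
apply: etrans (xt_law (ltn0Sn i) (measurable_set1 _)) _.
by apply: grid_law_set1; rewrite ?mesh_gt0 ?x01.
Qed.

Lemma sum_cell_widen m N y s (H : nat -> nat -> R) :
  0 <= y <= 1 -> 0 <= s <= 1 -> (m <= N)%N ->
  \sum_(c : 'I_N.+1 * 'I_N.+1) wgt m y c.1 * wgt m s c.2 * H c.1 c.2 =
  \sum_(c : 'I_m.+1 * 'I_m.+1) cell y s c * H c.1 c.2.
Proof.
move=> y01 s01 mN.
rewrite -(pair_big xpredT xpredT (fun a b : 'I_N.+1 => wgt m y a * wgt m s b * H a b))/=.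
rewrite -(pair_big xpredT xpredT (fun a b : 'I_m.+1 => wgt m y a * wgt m s b * H a b))/=.
under eq_bigr => a _ do (under eq_bigr do rewrite -mulrA; rewrite -mulr_sumr).
under [RHS]eq_bigr => a _ do (under eq_bigr do rewrite -mulrA; rewrite -mulr_sumr).
rewrite (sum_wgt_widen (fun a => \sum_(b < N.+1) wgt m s b * H a b))//.
by apply: eq_bigr => a _; rewrite (sum_wgt_widen (H a)).
Qed.

Lemma leq_mesh i j : (i <= j)%N -> (mesh i <= mesh j)%N.
Proof. by move=> ij; rewrite leq_pexp2l// leq_trunc_log. Qed.

(** [F] need not be measurable, so the deviation event is covered by a measurable [B]: the null
    off-grid events and the finitely many atoms on which the deviation is large. *)
Lemma rounding_tail (F : nat -> R -> R -> R) n :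
  (forall i (u v : R), (0 < i)%N -> 0 <= u <= 1 -> `|F i u v| <= 1) ->
  exists B : set T, [/\ measurable B,
    (P B <= (expR (- (2^-1 * Num.sqrt n%:R)))%:E)%E &
    forall w, ~ B w ->
      (forall i, (0 < i <= n)%N -> `|x i - xt i w| <= (mesh i)%:R^-1) /\
      \sum_(i < n) F i.+1 (pt i.+1 w) (xt i.+1 w) <=
      \sum_(i < n) \sum_(c : 'I_(mesh i.+1).+1 * 'I_(mesh i.+1).+1)
         cell (p i.+1) (x i.+1) c *
           F i.+1 (c.1%:R / (mesh i.+1)%:R) (c.2%:R / (mesh i.+1)%:R)
      + 4 * root4 n ^+ 3].
Proof.
move=> F1; have [->|n0] := posnP n.
  (* At [n = 0] the bound is 1. *)
  exists setT; split; [exact: measurableT| |by move=> w /(_ I)].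
  by rewrite probability_setT sqrtr0 mulr0 oppr0 expR0.
pose N := mesh n; pose r : R := root4 n; have r0 : 0 < r by exact: root4_gt0.
have r1 : 1 <= r by exact: root4_ge1.
pose w (i : 'I_n) (c : 'I_N.+1 * 'I_N.+1) :=
  wgt (mesh i.+1) (p i.+1) c.1 * wgt (mesh i.+1) (x i.+1) c.2.
pose z (i : 'I_n) (c : 'I_N.+1 * 'I_N.+1) :=
  F i.+1 (c.1%:R / (mesh i.+1)%:R) (c.2%:R / (mesh i.+1)%:R).
have mN (i : 'I_n) : (mesh i.+1 <= N)%N by apply: leq_mesh.
pose bad (f : {ffun 'I_n -> 'I_N.+1 * 'I_N.+1}) := 4 * r ^+ 3 < \sum_i z i (f i) - \sum_i \sum_c w i c * z i c.
have [mO PO] := @measure_bigsetU_le _ _ _ P 'I_n (index_enum _) xpredT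
  (fun i => off_grid i.+1) (fun=> 0) (fun i _ => off_grid_null (ltn0Sn i)).
have [mB PB] := @measure_bigsetU_le _ _ _ P _ (index_enum _) bad
  (@atom n N) (fun f => \prod_i w i (f i))
  (fun f _ => conj (measurable_atom f) (eq_ind _ (fun e => (e <= _)%E) (lexx _) _
     (esym (prob_atom f)))).
exists (\big[setU/set0]_(i < n) off_grid i.+1 `|` \big[setU/set0]_(f | bad f) atom f).
split; first exact: measurableU.
  rewrite (le_trans (measureU2 _ _ _))// (le_trans (leeD PO PB))// -EFinD lee_fin.
  (* With [r = n^(1/4)], Chernoff at [s = 1 / (4 r)] and [t = 4 r^3] has exponent [r^2 / 2 - r^2],
     and [s <= 1/4] because [r >= 1]. *)
  rewrite big1// add0r; apply: (@le_trans _ _ (expR (n%:R *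
    (8 * ((4 * r)^-1) ^+ 2) - (4 * r)^-1 * (4 * r ^+ 3)))); last first.
    rewrite ler_expR le_eqVlt; apply/orP; left; apply/eqP.
    by rewrite -root4_sqr -(root4_pow4 n) -/r; field; rewrite gt_eqF.
  apply: chernoff.
  - by move=> i c; rewrite mulr_ge0 ?wgt_ge0.
  - move=> i; under eq_bigr do rewrite -[w i _]mulr1.
    rewrite (sum_cell_widen (fun _ _ => 1)) ?p01 ?x01//.
    by under eq_bigr do rewrite mulr1; rewrite sum_cell ?p01 ?x01.
  - move=> i c wc; apply: F1 => //; rewrite divr_ge0//=.
    rewrite ler_pdivrMr ?ltr0n ?mesh_gt0// mul1r ler_nat leqNgt.
    by apply: contraNN wc => ?; rewrite /w wgt_gt ?mul0r ?p01.
  - apply/andP; split; first by rewrite invr_ge0 mulr_ge0 ?(ltW r0).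
    by rewrite lef_pV2 ?posrE ?mulr_gt0// ler_peMr.
move=> v nB.
have on (i : 'I_n) : grid_near (mesh i.+1) (p i.+1) (pt i.+1 v) /\
    grid_near (mesh i.+1) (x i.+1) (xt i.+1 v).
  have no : ~ off_grid i.+1 v.
    move=> o; apply: nB; left.
    exact: (@subset_bigsetU_fin _ _ xpredT (fun i : 'I_n => off_grid i.+1) i).
  by split; apply: contrapT => h; apply: no; [left|right].
split.
  move=> [//|i] /= ni; have [_ [a [_ xa] /= ->]] := on (Ordinal ni).
  exact: xa.
(* Off the null events the run lies in some atom [f]; a large deviation would make [f] bad and put
   [v] in [B]. *)
have /fin_all_exists[f fP] (i : 'I_n) : exists c : 'I_N.+1 * 'I_N.+1,
    pt i.+1 v = c.1%:R / (mesh i.+1)%:R /\ xt i.+1 v = c.2%:R / (mesh i.+1)%:R.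
  have [[a [am _] /= ->] [b [bm _] /= ->]] := on i.
  by exists (inord a, inord b); rewrite !inordK// ltnS (leq_trans _ (mN i)).
rewrite leNgt; apply/negP => h; apply: nB; right.
apply: (@subset_bigsetU_fin _ _ bad _ [ffun i => f i]); last first.
  by apply: atomP => i; rewrite ffunE.
rewrite /bad; under [X in X - _]eq_bigr => i _.
  rewrite /z ffunE -(proj1 (fP i)) -(proj2 (fP i)); over.
rewrite ltrBrDl; apply: le_lt_trans h; rewrite lerD2r ler_sum// => i _.
by rewrite /w /z (sum_cell_widen (fun a b =>
  F i.+1 (a%:R / (mesh i.+1)%:R) (b%:R / (mesh i.+1)%:R))) ?p01 ?x01.
Qed.

End Rounding.

(** * Calibration *)

Section Convergence.
Context {R : realType}.

Lemma cvg_root4V : ((root4 n : R)^-1 @[n --> \oo] --> (0 : R)).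
Proof.
apply/cvgrPdist_lt => e e0; near=> n.
have n0 : (0 < n)%N by near: n; exact: nbhs_infty_gt.
have r0 : 0 < root4 n :> R by exact: root4_gt0.
rewrite sub0r normrN gtr0_norm ?invr_gt0// invf_plt ?posrE//.
rewrite -(@ltr_pXn2r _ 4)// ?nnegrE ?(ltW r0) ?invr_ge0 ?(ltW e0)// root4_pow4.
by near: n; exact: nbhs_infty_gtr.
Unshelve. all: by end_near. Qed.

(** With [y = sqrt n / 2], the Taylor term [y^4 / 24] is quadratic in [n], hence dominates
    [(n + 1) (n + 2)] up to a constant. The bound is written as a difference so that it
    telescopes. *)
Lemma expR_tail_le n : expR (- (2^-1 * Num.sqrt n%:R)) <=
  800 * (n.+1%:R^-1 - n.+2%:R^-1) :> R.
Proof.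
set y : R := 2^-1 * Num.sqrt n%:R.
have y0 : 0 <= y by rewrite mulr_ge0 ?sqrtr_ge0.
have yE : y ^+ 4 = n%:R ^+ 2 / 16.
  by rewrite exprMn -root4_sqr -exprM (exprM _ 4 2) root4_pow4; field.
have h : 1 + n%:R ^+ 2 / 16 / 24%:R <= expR y.
  by have := expR_ge1Dxn 3 y0; rewrite yE.
rewrite expRN -[n.+2%:R]natr1 -[n.+1%:R]natr1; have n0 : 0 <= n%:R :> R by [].
move: (n%:R : R) n0 h => m m0 h.
have m1 : 0 < m + 1 by lra.
have m2 : 0 < m + 1 + 1 by lra.
rewrite (_ : _ - _ = ((m + 1) * (m + 1 + 1))^-1); last first.
  by field; rewrite !gt_eqF.
rewrite ler_pdivlMr ?mulr_gt0// mulrC ler_pdivrMr ?expR_gt0//.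
have h800 : 0 <= 800 :> R by exact: ler0n.
apply: (@le_trans _ _ (800 * (1 + m ^+ 2 / 16 / 24%:R))).
  by have := sqr_ge0 (m - 3); lra.
exact: ler_wpM2l h800 _ _ h.
Qed.

Lemma borel_cantelli_expR d (T : measurableType d) (P : probability T R)
    (B : nat -> set T) :
  (forall n, measurable (B n)) ->
  (forall n, (P (B n) <= (expR (- (2^-1 * Num.sqrt n%:R)))%:E)%E) ->
  P (lim_sup_set B) = 0%E.
Proof.
move=> mB PB; apply: lim_sup_set_cvg0 => //.
apply: (@le_lt_trans _ _ 800%:E); last exact: ltry.
apply: lime_le; first by apply: is_cvg_nneseries.
apply: nearW => n; apply: (@le_trans _ _
  (\sum_(0 <= i < n) (800 * (i.+1%:R^-1 - i.+2%:R^-1) : R)%:E)%E).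
  by apply: lee_sum => i _; rewrite (le_trans (PB i))// lee_fin expR_tail_le.
rewrite sumEFin lee_fin -mulr_sumr -[leRHS]mulr1 ler_wpM2l ?ler0n//.
under eq_bigr do rewrite -opprB; rewrite sumrN.
rewrite (telescope_sumr (fun i => i.+1%:R^-1))// opprB invr1.
by rewrite lerBlDr lerDl invr_ge0.
Qed.

(** Almost surely the rounded value is within [1/m] of [y]. *)
Lemma expectation_rounding_le d (T : measurableType d) (P : probability T R)
    (X : {RV P >-> R}) m (y : R) :
  (0 < m)%N -> 0 <= y <= 1 -> has_law X (grid_law m y) ->
  ('E_P[fun w => ((X w - y) ^+ 2)%R] <= ((m%:R^-1) ^+ 2)%:E)%E.
Proof.
move=> m0 y01 law.
rewrite -(expectation_cst P (m%:R^-1 ^+ 2)).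
apply: expectation_le => //.
- by apply: measurable_funX; apply: measurable_funB.
- by move=> w; rewrite sqr_ge0.
- by move=> w; rewrite sqr_ge0.
have mC : measurable (~` grid_near m y).
  by apply: measurableC; exact: measurable_grid_near.
exists (X @^-1` (~` grid_near m y)); split.
- by rewrite -[X in measurable X]setTI; exact: measurable_funP.
- by apply: etrans (law _ mC) _; apply: grid_law_near_setC.
- move=> w /=; apply: contra_not => -[a [_ ya] /= ->].
  rewrite -[_ ^+ 2]real_normK ?num_real// ler_pXn2r ?nnegrE ?invr_ge0//.
  by rewrite distrC.
Qed.

End Convergence.

Section Rounded.
Context {R : realType}.

Lemma grid_law_mesh_itv n (y : R) : 0 <= y <= 1 ->
  (grid_law (mesh n) y : probability R R) `[0, 1]%classic = 1%E.
Proof. by apply: grid_law_itv; exact: mesh_gt0. Qed.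

Lemma grid_law_mesh_mean n (y : R) : 0 <= y <= 1 ->
  ('E_(grid_law (mesh n) y : probability R R)[fun u => u] = y%:E)%E.
Proof. by apply: grid_law_mean; exact: mesh_gt0. Qed.

Definition grid_rounding : randomization_method R :=
  RandomizationMethod grid_law_mesh_itv grid_law_mesh_mean.

Section Run.
Context {d : measure_display} {T : measurableType d}.
Variables (P : probability T R) (S x : nat -> R) (pt xt : nat -> {RV P >-> R}).
Hypothesis S01 : forall i, (0 < i)%N -> 0 <= S i <= 1.
Hypothesis x01 : forall i, (0 < i)%N -> 0 <= x i <= 1.
Hypothesis run : randomized_run (@algorithm R) grid_rounding S x pt xt.

Lemma run_pt_law i : (0 < i)%N -> has_law (pt i) (grid_law (mesh i) (fcast S x i)).
Proof. by case: run => h _ _ /h; rewrite forecast_algorithm. Qed.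

Lemma run_xt_law i : (0 < i)%N -> has_law (xt i) (grid_law (mesh i) (x i)).
Proof. by case: run => _ h _ /h. Qed.

(** The constant is 8 for the conditional means plus 4 for the deviation. The bound is one-sided;
    the other side comes from [- G]. *)
Lemma run_tail (G : R -> R -> R) n : (forall u v, `|G u v| <= 1) ->
  exists B : set T, [/\ measurable B,
    (P B <= (expR (- (2^-1 * Num.sqrt n%:R)))%:E)%E &
    forall w, ~ B w ->
      (forall i, (0 < i <= n)%N -> `|x i - xt i w| <= (mesh i)%:R^-1) /\
      \sum_(i < n) G (pt i.+1 w) (xt i.+1 w) * (S i.+1 - pt i.+1 w) <=
        12 * root4 n ^+ 3].
Proof.
move=> G1; have [_ _ ind] := run.
have [|B [mB PB hB]] := rounding_tail (fun i _ => fcast_itv S x i) x01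
    run_pt_law run_xt_law ind (F := fun i u v => G u v * (S i - u)) n.
  move=> i u v i0 u01; rewrite normrM mulr_ile1//.
  by rewrite ler_norml; have := S01 i0; move: u01; lra.
exists B; split => // w /hB[near_x le_sum]; split => //.
apply: le_trans le_sum _.
have -> : 12 * root4 n ^+ 3 = 8 * root4 n ^+ 3 + 4 * root4 n ^+ 3 :> R by ring.
rewrite lerD2r; apply: le_trans (ler_norm _) _.
exact: conditional_mean_le.
Qed.

End Run.

Lemma cvg_expectation_rounding d (T : measurableType d) (P : probability T R)
    (X : nat -> {RV P >-> R}) (y : nat -> R) :
  (forall n, (0 < n)%N -> has_law (X n) (grid_law (mesh n) (y n))) ->
  (forall n, (0 < n)%N -> 0 <= y n <= 1) ->
  (fun n => 'E_P[fun w => ((X n w - y n) ^+ 2)%R]%E) @ \oo --> 0%E.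
Proof.
move=> law y01.
apply: (@squeeze_cvge _ _ _ _ (cst 0%E) _ (fun n => (2 / root4 n * (2 / root4 n))%:E)).
- near=> n; have n0 : (0 < n)%N by near: n; exact: nbhs_infty_gt.
  apply/andP; split; first by apply: expectation_ge0 => w; exact: sqr_ge0.
  apply: le_trans (expectation_rounding_le (mesh_gt0 n) (y01 _ n0) (law _ n0)) _.
  by rewrite lee_fin -expr2 lerXn2r ?nnegrE ?divr_ge0 ?root4_ge0// mesh_inv.
- exact: cvg_cst.
- apply: cvg_EFin; first exact: nearW.
  have h : (2 / root4 n @[n --> \oo] --> (0 : R)).
    rewrite -(mulr0 2); apply: cvgM; first exact: cvg_cst.
    exact: cvg_root4V.
  rewrite -(mulr0 0); exact: cvgM.
Unshelve. all: by end_near. Qed.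

Lemma calibrated_algorithm : calibrated (@algorithm R) grid_rounding.
Proof.
move=> S x S01 x01 d T P pt xt run; split.
- move=> E _.
  pose G (u v : R) : R := \1_E (u, v).
  have G1 u v : `|G u v| <= 1.
    by rewrite /G indicE; case: (_ \in _); rewrite ?normr1 ?normr0.
  have NG1 u v : `|- G u v| <= 1 by rewrite normrN.
  have /choice[B hB] := fun n => run_tail S01 x01 run n G1.
  have /choice[C hC] := fun n => run_tail S01 x01 run n NG1.
  have mB n : measurable (B n) by case: (hB n).
  have mC n : measurable (C n) by case: (hC n).
  have B0 : P (lim_sup_set B) = 0%E.
    by apply: borel_cantelli_expR => // n; case: (hB n).
  have C0 : P (lim_sup_set C) = 0%E.
    by apply: borel_cantelli_expR => // n; case: (hC n).
  have mlim (F : nat -> set T) : (forall n, measurable (F n)) ->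
      measurable (lim_sup_set F).
    by move=> mF; apply: bigcap_measurable => // k _; exact: bigcup_measurable.
  have : P.-negligible (lim_sup_set B `|` lim_sup_set C).
    by apply: negligibleU; apply/negligibleP => //; exact: mlim.
  (* Outside both limsup sets, [w] eventually avoids [B n] and [C n], so the two one-sided bounds
     hold for all large [n]. *)
  apply: negligibleS => w /=; apply: contra_notP => nw.
  have ev (F : nat -> set T) : ~ lim_sup_set F w -> \forall n \near \oo, ~ F n w.
    move=> h; have /existsNP[N hN] : ~ forall N, (\bigcup_(j >= N) F j) w.
      by move=> h'; apply: h => N _; exact: h'.
    by exists N => // n /= Nn Fn; apply: hN; exists n.
  have evB : \forall n \near \oo, ~ B n w by apply: ev => h; apply: nw; left.
  have evC : \forall n \near \oo, ~ C n w by apply: ev => h; apply: nw; right.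
  have c12 : (12 * (root4 n)^-1 @[n --> \oo] --> (0 : R)).
    rewrite -(mulr0 12); apply: cvgM; first exact: cvg_cst.
    exact: cvg_root4V.
  apply: (@squeeze_cvgr _ _ _ _ (fun n => - (12 * (root4 n)^-1)) (fun n => 12 * (root4 n)^-1)) => //; last first.
    by rewrite -oppr0; exact: cvgN.
  near=> n.
  have n0 : (0 < n)%N by near: n; exact: nbhs_infty_gt.
  have nB : ~ B n w by near: n.
  have nC : ~ C n w by near: n.
  have [_ _ /(_ _ nB)[_ le1]] := hB n.
  have [_ _ /(_ _ nC)[_ le2]] := hC n.
  have r0 : 0 < root4 n :> R by exact: root4_gt0.
  rewrite big_add1 big_mkord /= -/(G _ _).
  have e : 12 * (root4 n)^-1 = n%:R^-1 * (12 * root4 n ^+ 3) :> R.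
    by rewrite -(root4_pow4 n); field; rewrite gt_eqF.
  rewrite e -mulrN !ler_pM2l ?invr_gt0 ?ltr0n// le1 andbT.
  rewrite lerNl -sumrN (le_trans _ le2)// ler_sum// => i _.
  by rewrite /G mulNr.
- under eq_fun do rewrite forecast_algorithm.
  apply: cvg_expectation_rounding; first exact: run_pt_law run.
  by move=> i _; exact: fcast_itv.
- by apply: cvg_expectation_rounding => //; exact: run_xt_law run.
Unshelve. all: by end_near. Qed.

End Rounded.

(** * Trading *)

Section Gain.
Context {R : realType}.

Lemma root4_cube_le n (nu : R) : (0 < n)%N -> 0 <= nu ->
  root4 n ^+ 3 <= n%:R `^ (3 / 4 + nu).
Proof.
move=> n0 nu0; apply: (@le_trans _ _ (n%:R `^ (3 / 4))); last first.
  by rewrite ler_powR ?ler1n// lerDl.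
rewrite -[n%:R in leRHS](root4_pow4 n) -!powR_mulrn ?root4_ge0// -powRrM.
by rewrite (_ : 4%:R * (3 / 4) = 3%:R)//; field.
Qed.

Variables (eps : R) (p q S : nat -> R).

Lemma gambles_ord n : gambles eps p q n = \sum_(i < n) entry eps p q i.+1.
Proof. by rewrite /gambles big_add1 big_mkord. Qed.

Lemma total_gain_ord n : total_gain eps p q S n =
  \sum_(i < n) entry eps p q i.+1 * (S i.+1 - S i).
Proof. by rewrite /total_gain big_add1 big_mkord. Qed.

(* S_i - S_(i-1) splits into the forecasting error S_i - p_i, the margin
   p_i - q_i > eps of the entry rule, and the rounding error q_i - S_(i-1). *)
Lemma total_gain_ge n :
  (forall i, (0 < i <= n)%N -> `|S i.-1 - q i| <= (mesh i)%:R^-1) ->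
  \sum_(i < n) - entry eps p q i.+1 * (S i.+1 - p i.+1) <= 12 * root4 n ^+ 3 ->
  eps * gambles eps p q n - 16 * root4 n ^+ 3 <= total_gain eps p q S n.
Proof.
move=> near_q le_err; rewrite gambles_ord total_gain_ord.
(* 12 pays for the forecasting errors and 4 for the rounding of the past prices. *)
have -> : 16 * root4 n ^+ 3 = 12 * root4 n ^+ 3 + 4 * root4 n ^+ 3 :> R by ring.
rewrite opprD addrA lerBlDr lerBlDr.
apply: le_trans (lerD (lerD (lexx _) (sum_mesh_inv n)) le_err).
rewrite mulr_sumr -!big_split /= ler_sum// => i _; rewrite /entry.
have := near_q i.+1 (ltn_ord i); rewrite /= ler_norml => /andP[h1 h2].
by case: ltP => h; rewrite /=; lra.
Qed.

(** Above the threshold, the error [16 n^(3/4)] is at most the fraction [gamma] of [eps] times the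
    number of gambles. *)
Lemma gain_ge_of_gambles n (gamma theta : R) : 0 < gamma * eps ->
  16 * root4 n ^+ 3 <= gamma * eps * theta -> theta <= gambles eps p q n ->
  eps * gambles eps p q n - 16 * root4 n ^+ 3 <= total_gain eps p q S n ->
  (1 - gamma) * eps * gambles eps p q n <= total_gain eps p q S n.
Proof.
move=> ge0 le16 le_theta; apply: le_trans.
have : gamma * eps * theta <= gamma * eps * gambles eps p q n.
  by rewrite ler_pM2l.
by lra.
Qed.

End Gain.

Lemma measurable_entry d (T : measurableType d) (R : realType) (eps : R)
    (p q : nat -> T -> R) i :
  measurable_fun setT (p i) -> measurable_fun setT (q i) ->
  measurable_fun setT (fun w => entry eps (p ^~ w) (q ^~ w) i).
Proof.
move=> mp mq; rewrite (_ : (fun w => _) =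
  (fun w => if q i w + eps < p i w then 1 else 0)); last first.
  by apply/funext => w; rewrite /entry; case: (_ < _).
apply: measurable_fun_ifT => //; apply: measurable_fun_ltr => //.
exact: measurable_funD.
Qed.

Lemma measurable_ler_set d (T : measurableType d) (R : realType) (f g : T -> R) :
  measurable_fun setT f -> measurable_fun setT g ->
  measurable [set w | f w <= g w].
Proof.
move=> mf mg; have := measurable_fun_ler mf mg measurableT (Y := [set true]) I.
by rewrite setTI.
Qed.

Theorem proposition1 (R : realType) (M : nat) (M_gt0 : (0 < M)%N) :
  let nu : R := 1 / M%:R in
  exists (A : forecasting_algorithm R) (D : randomization_method R),
    calibrated A D /\
    exists c c' : R, 0 < c /\ 0 < c' /\
    forall S : nat -> R, (forall i, 0 <= S i <= 1) -> S 1%N = S 0%N ->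
    forall eps gamma : R, 0 < eps < 1 -> 0 < gamma < 1 ->
    forall (n : nat) (d : measure_display) (T : measurableType d)
      (P : probability T R) (pt xt : nat -> {RV P >-> R}),
    randomized_run A D S (fun i => S i.-1) pt xt ->
    ((1 - expR (- (c' * Num.sqrt n%:R)))%:E <=
     P [set w : T |
         (c * (n%:R `^ (3 / 4 + nu)) / (gamma * eps)
            <= gambles eps (fun i => pt i w) (fun i => xt i w) n)%R ->
         ((1 - gamma) * eps <=
            average_income eps (fun i => pt i w) (fun i => xt i w) S n)%R])%E.
Proof.
move=> nu; exists (@algorithm R), grid_rounding; split.
  exact: calibrated_algorithm.
(* 16 is the constant of [total_gain_ge], and 1/2 comes from the Chernoff exponent. *)
exists 16, 2^-1; split; first by rewrite ltr0n.
split; first by rewrite invr_gt0 ltr0n.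
move=> S S01 _ eps gamma /andP[eps0 _] /andP[gamma0 _] n d T P pt xt run.
have [->|n0] := posnP n.
  by rewrite sqrtr0 mulr0 oppr0 expR0 subrr measure_ge0.
have ge0 : 0 < gamma * eps by rewrite mulr_gt0.
set thr := 16 * _ / _.
have pow_gt0 : 0 < n%:R `^ (3 / 4 + nu) by rewrite powR_gt0// ltr0n.
have thr0 : 0 < thr by rewrite divr_gt0// mulr_gt0 ?ltr0n.
have le16 : 16 * root4 n ^+ 3 <= gamma * eps * thr.
  rewrite /thr [leRHS]mulrC divfK ?gt_eqF// ler_wpM2l ?ler0n//.
  by apply: root4_cube_le; rewrite ?divr_ge0.
set good := [set w | _].
pose gam w := gambles eps (fun i => pt i w) (fun i => xt i w) n.
pose gain w := total_gain eps (fun i => pt i w) (fun i => xt i w) S n.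
(* The positive threshold makes the number of gambles positive, so the division in [average_income]
   can be cleared. *)
have goodE : good = ~` [set w | thr <= gam w] `|`
    [set w | (1 - gamma) * eps * gam w <= gain w].
  apply/seteqP; split => w; rewrite /good /=.
    have [h /(_ isT) h'|] := boolP (thr <= gam w); last by left; exact/negP.
    right; move: h'; rewrite /average_income ler_pdivlMr//.
    exact: lt_le_trans h.
  move=> [nh /nh//|h h']; rewrite /average_income ler_pdivlMr//.
  exact: lt_le_trans h'.
have mentry i : measurable_fun setT
    (fun w => entry eps (fun i => pt i w) (fun i => xt i w) i).
  by apply: measurable_entry.
have mgam : measurable_fun setT gam by apply: measurable_sum => i; exact: mentry.
have mgain : measurable_fun setT gain.
  by apply: measurable_sum => i; apply: measurable_funM.
have mgood : measurable good.
  rewrite goodE; apply: measurableU; first apply: measurableC.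
    exact: measurable_ler_set.
  by apply: measurable_ler_set => //; exact: measurable_funM.
(* The sign turns the upper bound of [run_tail] into a lower bound on the errors summed over the
   steps with a gamble. *)
pose G (u v : R) : R := - (v + eps < u)%R%:R.
have G1 u v : `|G u v| <= 1.
  by rewrite /G normrN; case: (_ < _); rewrite ?normr1 ?normr0.
have [B [mB PB hB]] :=
  run_tail (fun i _ => S01 i) (fun i _ => S01 i.-1) run n G1.
apply: (@le_trans _ _ (P (~` B))).
  by rewrite probability_setC// EFinB leeB.
rewrite le_measure ?inE//; first exact: measurableC.
move=> w /hB[near_x le_err]; rewrite goodE.
have [h|] := boolP (thr <= gam w); last by left; exact/negP.
right; apply: (gain_ge_of_gambles ge0 le16 h).
exact: total_gain_ge.
Qed.
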